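(* Let $d,\lambda$ be positive integers with $d\ge\lambda$ and $\alpha(d,\lambda)<1$. Then $$\lim_{k\to\infty}\frac{\zeta(k,d,\lambda)}{k}=2-\alpha(d,\lambda).$$
   Context: For a finite set $X\subset\mathbb{R}^d$, a $(d-\lambda)$-plane $L$ is a complete Kneser $(d-\lambda)$-transversal (to the convex hulls of the $k$-subsets of $X$) if $L$ intersects $\operatorname{conv}(K)$ for every $k$-element subset $K\subseteq X$ and $L$ contains $d-\lambda+1$ points of $X$. The moment curve is $\gamma(t)=(t,t^2,\ldots,t^d)$; a cyclic polytope with $n$ vertices is the convex hull of $\{\gamma(t_1),\ldots,\gamma(t_n)\}$ for reals $t_1<\cdots<t_n$ (its combinatorial type does not depend on the $t_i$). $\zeta(k,d,\lambda)$ is the maximum number of vertices a cyclic polytope in $\mathbb{R}^d$ can have so that its vertex set has a complete Kneser $(d-\lambda)$-transversal to the convex hulls of its $k$-subsets of vertices. $\alpha(d,\lambda)=\frac{\lambda-1}{\lceil d/2\rceil}$. *)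

(* Defs.v *)
From mathcomp Require Export all_boot all_order all_algebra finmap.
From mathcomp Require Export boolp classical_sets reals topology normedtype sequences convex.

Set Implicit Arguments.
Unset Strict Implicit.
Unset Printing Implicit Defensive.

Import Order.TTheory GRing.Theory Num.Theory.
Import numFieldNormedType.Exports.

Local Open Scope classical_set_scope.
Local Open Scope ring_scope.

Section KneserTransversals.
Variables (R : realType) (d : nat).
Implicit Types (X K : {fset 'rV[R]_d}) (L : set 'rV[R]_d).

Definition convex_hull (A : set 'rV[R]_d) : set 'rV[R]_d :=
  smallest (fun C : set (convex_lmodType 'rV[R]_d) => convex_set C) A.

Definition is_plane (m : nat) L :=
  exists (p : 'rV[R]_d) (V : {vspace 'rV[R]_d}),
    \dim V = m /\ L = [set p + v | v in [set` V]].

Definition complete_Kneser_transversal (k m : nat) X L :=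
  [/\ is_plane m L,
      forall K, (K `<=` X)%fset -> #|` K| = k ->
        L `&` convex_hull [set` K] !=set0
    & exists S : {fset 'rV[R]_d},
        [/\ (S `<=` X)%fset, #|` S| = m.+1 & [set` S] `<=` L] ].

Definition moment_curve (t : R) : 'rV[R]_d := \row_(i < d) t ^+ i.+1.

(* The points gamma(t_1), ..., gamma(t_n) themselves are taken as the vertex
   set; for d >= 2 they are all extreme points of their convex hull, whereas
   for d = 1 the hull is a segment. *)
Definition cyclic_vertices (n : nat) (t : 'I_n -> R) : {fset 'rV[R]_d} :=
  [fset moment_curve (t i) | i : 'I_n]%fset.

Definition zeta_feasible (k lambda n : nat) :=
  exists2 t : 'I_n -> R,
    {homo t : i j / (i < j)%N >-> i < j} &
    exists L, complete_Kneser_transversal k (d - lambda) (cyclic_vertices t) L.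

End KneserTransversals.

(* The maximum of the feasible n, with default value 0 if there is none; for
   1 <= lambda <= d the maximum exists exactly when k > 0. *)
Definition zeta (R : realType) (k d lambda : nat) : nat :=
  xget 0%N [set n | zeta_feasible R d k lambda n /\
    forall m, zeta_feasible R d k lambda m -> (m <= n)%N].

(* [uphalf d] is the ceiling of d / 2. *)
Definition alpha (R : realType) (d lambda : nat) : R :=
  (lambda%:R - 1) / (uphalf d)%:R.

(* Main.v *)
(* Put c = ceil(d/2), r = lambda - 1, M = 2c - r and m = d - lambda + 1, so that
   alpha = r/c and 2 - alpha = M/c.  Let S be the m points of X on L.  We show
   [m + M * floor((k - 1)/c) <= zeta <= m + M * (k - 1)/c].

   Lower bound: let S cut the curve into M blocks (the last one ends in a point
   of S when d is even) of a = floor((k - 1)/c) further points each.  Among k of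
   these points, more than c have the same position inside their block; these
   interlace with points of S, giving d + 2 points of the curve that alternate
   between K and S.  Divided differences yield an affine dependence with
   alternating signs, so conv K meets conv S, which lies in L.

   Upper bound: affine functions vanishing on L are polynomials of degree at
   most d vanishing at the parameters of S, and such a polynomial is positive at
   fewer than k points of X outside S.  Arrange S cyclically, with a point at
   infinity added when d is odd, so that there are M points, and let p_i change
   sign exactly at those in the i-th cyclic window of length 2(c - r), with
   double roots at the other ones.  Up to sign, every point of X outside S is in
   the positive set of exactly c of the M polynomials p_i, so the number N of
   such points satisfies c * N <= M * (k - 1). *)
From HB Require Import structures.
Require Import Defs.
From mathcomp Require Import zify ring lra interval_inference.

Set Implicit Arguments.
Unset Strict Implicit.

Import Order.TTheory GRing.Theory Num.Theory.
Import numFieldNormedType.Exports.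
Local Open Scope classical_set_scope.
Local Open Scope ring_scope.

(** * Affine dependences on the moment curve *)

(** The sum is the coefficient of X^n in the Lagrange interpolant of [p] at the [n.+1] nodes. That
    interpolant is [p] itself, which has degree below n. *)
Lemma divided_difference (F : fieldType) n (u : 'I_n.+1 -> F) (p : {poly F}) :
  injective u -> (size p <= n)%N ->
  \sum_i p.[u i] / \prod_(j | j != i) (u i - u j) = 0.
Proof.
move=> u_inj szp; pose P i := \prod_(j | j != i) ('X - (u j)%:P).
have PuE i : (P i).[u i] = \prod_(j | j != i) (u i - u j).
  by rewrite horner_prod; under eq_bigr do rewrite hornerXsubC.
have Pu_neq0 i : (P i).[u i] != 0.
  rewrite PuE; apply/prodf_neq0 => j ji.
  by rewrite subr_eq0 (inj_eq u_inj) eq_sym.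
have szP i : size (P i) = n.+1.
  rewrite /P -big_filter size_prod_XsubC -sum1_size big_filter sum1_card.
  by rewrite cardC1 card_ord.
pose w i := p.[u i] / (P i).[u i].
have interp : p = \sum_i w i *: P i.
  apply/eqP; rewrite -subr_eq0; apply/negPn/negP.
  set q := p - _ => q_neq0.
  have := max_poly_roots q_neq0 (rs := [seq u i | i <- enum 'I_n.+1]).
  rewrite map_inj_uniq ?enum_uniq // size_map size_enum_ord ltnNge.
  have -> : (size q <= n.+1)%N.
    rewrite (leq_trans (size_polyD _ _))// geq_max size_polyN.
    rewrite leqW//= (leq_trans (size_sum _ _ _))//; apply/bigmax_leqP => i _.
    by rewrite (leq_trans (size_scale_leq _ _))// szP.
  suff rt : all (root q) [seq u i | i <- enum 'I_n.+1] by move=> /(_ rt isT).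
  apply/allP => _ /mapP[i _ ->]; rewrite /root /q !hornerE horner_sum.
  rewrite (bigD1 i) //= big1 ?addr0 => [|j ji].
    by rewrite hornerE divfK ?subrr.
  rewrite hornerE; suff -> : (P j).[u i] = 0 by rewrite mulr0.
  by rewrite horner_prod (bigD1 i) 1?eq_sym //= hornerXsubC subrr mul0r.
have := congr1 (fun q : {poly F} => q`_n) interp.
rewrite coef_sum (nth_default _ szp) => coef_n; rewrite [RHS]coef_n.
apply: eq_bigr => i _; rewrite coefZ /w PuE; set x := _ / _.
have -> : (P i)`_n = 1; last by rewrite mulr1.
have /monicP : P i \is monic by rewrite /P -big_filter monic_prod_XsubC.
by rewrite lead_coefE szP.
Qed.

Lemma homo_ord_inj (R : realDomainType) n (t : 'I_n -> R) :
  {homo t : i j / (i < j)%N >-> i < j} -> injective t.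
Proof.
move=> t_incr i j tij; case: (ltngtP i j) => [/t_incr|/t_incr|/val_inj //].
  by rewrite tij ltxx.
by rewrite tij ltxx.
Qed.

Lemma sgr_prod (R : realDomainType) (I : Type) (s : seq I) (P : pred I)
    (F : I -> R) :
  Num.sg (\prod_(i <- s | P i) F i) = \prod_(i <- s | P i) Num.sg (F i).
Proof. by apply: (big_morph _ (@sgrM R)); rewrite sgr1. Qed.

(** The weights are the absolute values of the coefficients of a divided difference. The signs of
    these coefficients alternate because exactly [i] nodes lie below [u i]. *)
Lemma alternating_dependence (R : realFieldType) n (u : 'I_n.+1 -> R) :
  {homo u : i j / (i < j)%N >-> i < j} ->
  exists2 w : 'I_n.+1 -> R, forall i, 0 < w i &
    forall p : {poly R}, (size p <= n)%N ->
      \sum_(i < n.+1) (-1) ^+ i * w i * p.[u i] = 0.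
Proof.
move=> u_incr; pose Q (i : 'I_n.+1) := \prod_(j | j != i) (u j - u i).
have uD (i j : 'I_n.+1) : j != i -> Num.sg (u j - u i) = (-1) ^+ (j < i)%N.
  rewrite -val_eqE neq_ltn => /orP[] ij; move: (u_incr _ _ ij).
    by rewrite ij expr1 -subr_lt0 => /ltr0_sg ->.
  by rewrite -subr_gt0 ltnNge (ltnW ij) expr0 => /gtr0_sg ->.
have sgQ i : Num.sg (Q i) = (-1) ^+ i.
  rewrite sgr_prod (eq_bigr _ (uD i)) prodrXr; congr (_ ^+ _).
  rewrite -[RHS]card_ord -sum1_card (big_ord_widen n.+1 (fun=> 1%N)) 1?ltnW //.
  rewrite [LHS]big_mkcond [RHS]big_mkcond /=; apply: eq_bigr => j _.
  by case: eqVneq => [->|_]; rewrite ?ltnn //; case: (j < i)%N.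
exists (fun i => `|Q i|^-1) => [i|p szp].
  by rewrite invr_gt0 normr_gt0 -sgr_eq0 sgQ signr_eq0.
have /(congr1 ( *%R ((-1) ^+ n))) :=
  divided_difference (homo_ord_inj u_incr) szp.
rewrite mulr0 mulr_sumr => dd; rewrite -[RHS]dd; apply: eq_bigr => i _.
rewrite mulrCA [RHS]mulrC; congr (_ * _).
have -> : \prod_(j | j != i) (u i - u j) = (-1) ^+ n * Q i.
  under eq_bigr do rewrite -opprB.
  by rewrite prodrN cardC1 card_ord.
by rewrite invfM invr_sign signrMK [in RHS](numEsg (Q i)) sgQ invfM invr_sign.
Qed.

(** Adding the constant coefficient of [p] gives the affine function on R^d whose restriction to the
    moment curve is [p], for [p] of degree at most d. *)
Definition linear_part (R : realType) d (p : {poly R}) (x : 'rV[R]_d) : R :=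
  \sum_(i < d) p`_i.+1 * x 0 i.

Fact linear_part_is_linear (R : realType) d (p : {poly R}) :
  linear_for *%R (@linear_part R d p).
Proof.
move=> a x y; rewrite /linear_part mulr_sumr -big_split; apply: eq_bigr => i _.
by rewrite !mxE mulrDr mulrCA.
Qed.

HB.instance Definition _ (R : realType) d (p : {poly R}) :=
  GRing.isLinear.Build R 'rV[R]_d R *%R (@linear_part R d p)
    (@linear_part_is_linear R d p).

Lemma linear_part_moment_curve (R : realType) d (p : {poly R}) (t : R) :
  (size p <= d.+1)%N -> linear_part p (moment_curve d t) = p.[t] - p`_0.
Proof.
move=> szp; rewrite (horner_coef_wide _ szp) big_ord_recl expr0 mulr1.
rewrite addrC addKr.
by apply: eq_bigr => i _; rewrite !mxE.
Qed.

Lemma moment_curve_inj (R : realType) d :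
  (0 < d)%N -> injective (@moment_curve R d).
Proof. by case: d => // d _ t u /rowP/(_ 0); rewrite !mxE !expr1. Qed.

Definition chords (R : realType) d m (s : 'I_m.+1 -> R) : m.-tuple 'rV[R]_d :=
  [tuple moment_curve d (s (lift ord0 l)) - moment_curve d (s ord0) | l < m].

Lemma nth_chords (R : realType) d m (s : 'I_m.+1 -> R) (l : 'I_m) :
  (chords d s)`_l = moment_curve d (s (lift ord0 l)) - moment_curve d (s ord0).
Proof. by rewrite -tnth_nth tnth_mktuple. Qed.

Lemma linear_part_chord (R : realType) d m (s : 'I_m.+1 -> R)
    (p : {poly R}) (l : 'I_m) :
  (size p <= d.+1)%N ->
  linear_part p (chords d s)`_l = p.[s (lift ord0 l)] - p.[s ord0].
Proof.
move=> szp; rewrite nth_chords linearB /= !linear_part_moment_curve //.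
by rewrite opprB addrA subrK.
Qed.

(** A vanishing combination is tested against a polynomial whose roots are all parameters but one;
    its linear part kills every chord except the [l]-th. *)
Lemma chords_free (R : realType) d m (s : 'I_m.+1 -> R) :
  injective s -> (m <= d)%N -> free (chords d s).
Proof.
move=> s_inj md; apply/freeP => k sum0 l.
pose q := \prod_(j | j != lift ord0 l) ('X - (s j)%:P).
have szq : (size q <= d.+1)%N.
  rewrite /q -big_filter size_prod_XsubC -sum1_size big_filter sum1_card.
  by rewrite cardC1 card_ord.
have q0 j : j != lift ord0 l -> q.[s j] = 0.
  by move=> jl; rewrite horner_prod (bigD1 j) //= hornerXsubC subrr mul0r.
have ql : q.[s (lift ord0 l)] != 0.
  rewrite horner_prod; apply/prodf_neq0 => j jl.
  by rewrite hornerXsubC subr_eq0 (inj_eq s_inj) eq_sym.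
have := congr1 (linear_part q) sum0.
rewrite linear0 linear_sum (bigD1 l) //= big1 ?addr0 => [|j jl].
  rewrite linearZ /= linear_part_chord // [q.[s ord0]]q0 // subr0 => /eqP.
  by rewrite mulf_eq0 (negPf ql) orbF => /eqP.
by rewrite linearZ /= linear_part_chord // !q0 ?subrr ?mulr0 //
  (inj_eq lift_inj).
Qed.

(* [m.+1] points of the curve span an [m]-plane, so a polynomial that vanishes
   at their parameters vanishes, as an affine function, on the whole plane. *)
Lemma plane_affine_eq0 (R : realType) d m (L : set 'rV[R]_d)
    (s : 'I_m.+1 -> R) (p : {poly R}) :
  injective s -> (m <= d)%N -> is_plane m L ->
  (forall l, L (moment_curve d (s l))) ->
  (size p <= d.+1)%N -> (forall l, p.[s l] = 0) ->
  forall x, L x -> linear_part p x + p`_0 = 0.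
Proof.
move=> s_inj md [o [V [dimV ->]]] sL szp p_s.
have chordV l : moment_curve d (s l) - moment_curve d (s ord0) \in V.
  have [/= v vV <-] := sL l; have [/= w wV <-] := sL ord0.
  by rewrite opprD addrACA subrr add0r rpredB.
(* The chords are [m] independent vectors in a space of dimension [m], so it suffices that the
   linear part vanishes on them. *)
have : basis_of V (chords d s).
  rewrite basisEfree chords_free // size_tuple dimV leqnn andbT /=.
  apply/span_subvP => _ /(nthP 0)[l + <-].
  rewrite (size_tuple (chords d s)) => lm.
  by rewrite (nth_chords d s (Ordinal lm)).
move=> /andP[/eqP spanV _].
have linV v : v \in V -> linear_part p v = 0.
  rewrite -spanV => /coord_span ->; rewrite linear_sum big1 // => l _.
  by rewrite linearZ /= linear_part_chord // !p_s subrr mulr0.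
move=> _ /= [v vV <-].
have [/= w wV ow] := sL ord0.
have := linear_part_moment_curve (s ord0) szp.
rewrite -ow p_s sub0r !linearD /= (linV _ wV) (linV _ vV).
by rewrite !addr0 => ->; rewrite addNr.
Qed.

(** The positive set of an affine function is convex, so it contains the smallest convex set around
    [K]. *)
Lemma convex_hull_gt0 (R : realType) d (K : set 'rV[R]_d) (p : {poly R}) :
  (forall x, K x -> 0 < linear_part p x + p`_0) ->
  forall x, convex_hull K x -> 0 < linear_part p x + p`_0.
Proof.
move=> K_gt0; apply: smallest_sub => // x y t; rewrite !inE /= => x_gt0 y_gt0.
have := convR_gt0 t x_gt0 y_gt0; congr (0 < _).
rewrite !convRE /=.
transitivity (linear_part p (t%:num *: x + (1 - t%:num) *: y) + p`_0) => //.
by rewrite linearD !linearZ /= /unstable.onem; ring.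
Qed.

(** Convexity concerns two points only; the induction splits off the head of the list with weight
    [w i / (w i + W)]. *)
Lemma convex_set_weighted_mean (R : realType) (E : lmodType R) (C : set E)
    (I : eqType) (s : seq I) (w : I -> R) (x : I -> E) :
  convex_set (C : set (convex_lmodType E)) -> s != [::] ->
  (forall i, 0 < w i) -> {in s, forall i, C (x i)} ->
  C ((\sum_(i <- s) w i)^-1 *: \sum_(i <- s) w i *: x i).
Proof.
move=> convC + w_gt0; elim: s => [//|i [|j s] IH] _ sC.
  rewrite !big_seq1 scalerA mulVf ?gt_eqF // scale1r.
  by apply: sC; exact: mem_head.
have {IH} := IH isT (fun k ks => sC k (@mem_behead _ [:: i, j & s] k ks)).
rewrite 2!(big_cons _ _ i); set W := \sum_(_ <- _) _.
set y := \sum_(_ <- _) _ => Cy.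
have W_gt0 : 0 < W.
  by rewrite /W big_cons ltr_wpDr // sumr_ge0 // => k _; exact: ltW.
have wW_gt0 : 0 < w i + W by rewrite addr_gt0.
have a_ge0 : 0 <= w i / (w i + W) by rewrite divr_ge0 // ltW.
have a_le1 : w i / (w i + W) <= 1 by rewrite ler_pdivrMr // mul1r lerDl ltW.
have Cx : C (x i) by apply: sC; exact: mem_head.
have := convC (x i) (W^-1 *: y) (Itv01 a_ge0 a_le1).
rewrite !inE => /(_ Cx Cy); congr C.
transitivity
  ((w i / (w i + W)) *: x i + (1 - w i / (w i + W)) *: (W^-1 *: y)) => //.
rewrite scalerDr !scalerA [_^-1 * _]mulrC; congr (_ + _ *: _).
have W_neq0 : W != 0 by rewrite gt_eqF.
have wW_neq0 : w i + W != 0 by rewrite gt_eqF.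
by field; rewrite W_neq0 wW_neq0.
Qed.

(** * Upper bound *)

(* The [l]-th of the [h.*2 + r] cyclically arranged points lies in the window of
   length [h.*2] starting at [i]; the truncated [i - r] counts the points of the
   window that wrap around to the beginning. *)
Definition in_window (h r i l : nat) : bool :=
  (l < i - r)%N || (i <= l < i + h.*2)%N.

Lemma sum_in_window h r i j : (i < h.*2 + r)%N -> (j <= h.*2 + r)%N ->
  (\sum_(l < j) in_window h r i l = minn j (i - r) + minn (j - i) h.*2)%N.
Proof.
move=> iM; elim: j => [|j IH] jM; first by rewrite big_ord0; lia.
by rewrite big_ord_recr /= IH /in_window; lia.
Qed.

(** Half of the [u] below [h.*2] are even, and the other [r] values are all truncated to the even
    number [h.*2]. *)
Lemma sum_even_truncated h r :
  (\sum_(0 <= u < h.*2 + r) ~~ odd (minn u h.*2) = h + r)%N.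
Proof.
elim: r => [|r IH].
  rewrite !addn0 (eq_big_nat _ _ (F2 := fun u => (~~ odd u : nat)));
    last by move=> u ?; congr (nat_of_bool (~~ odd _)); lia.
  elim: h => [|h IH]; first by rewrite big_nil.
  by rewrite doubleS !big_nat_recr //= IH odd_double /=; lia.
rewrite addnS big_nat_recr //= IH (minn_idPr _) ?leq_addr // odd_double; lia.
Qed.

(** This counts the window polynomials that are positive at a point with exactly [j] nodes to its
    left. Reversing [i] separately on [i <= j] and on [i > j] turns the exponent, modulo 2, into
    [minn u h.*2]. *)
Lemma sum_window_parity h r j : (j <= h.*2 + r)%N ->
  (\sum_(i < h.*2 + r)
     ~~ odd ((i - r) + \sum_(l < j) in_window h r i l) = h + r)%N.
Proof.
move=> jM; rewrite -[RHS](sum_even_truncated h r).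
pose f i : nat := ~~ odd ((i - r) + (minn j (i - r) + minn (j - i) h.*2)).
rewrite (eq_bigr (fun i : 'I__ => f i)) => [|i _];
  last by rewrite sum_in_window.
rewrite -(big_mkord xpredT f) {}/f.
case: (ltnP j (h.*2 + r)) => [{}jM|Mj].
  rewrite (big_cat_nat (n := j.+1)) //= [RHS](big_cat_nat (n := j.+1)) //=.
  congr addn; rewrite big_nat_rev /= [LHS]big_nat [RHS]big_nat;
    apply: eq_bigr => i ij.
    by lia.
  by lia.
have {Mj} -> : j = (h.*2 + r)%N by lia.
case: (posnP (h.*2 + r)) => [->|M_gt0]; first by rewrite !big_nil.
(* No [i] exceeds [j] here, and the reversal lets [u] run from 1 to [h.*2 + r]. The last value is
   truncated to [h.*2], so it has the parity of the missing [u = 0]. *)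
rewrite big_nat_rev /= -(prednK M_gt0) big_nat_recr //= [RHS]big_nat_recl //=.
rewrite addnC.
congr addn; first by lia.
rewrite [LHS]big_nat [RHS]big_nat; apply: eq_bigr => i ij.
by lia.
Qed.

Lemma size_prod_le (R : idomainType) (I : Type) (s : seq I) (F : I -> {poly R})
    (e : I -> nat) :
  (forall i, size (F i) <= (e i).+1)%N ->
  (size (\prod_(i <- s) F i)%R <= (\sum_(i <- s) e i).+1)%N.
Proof.
move=> Fe; elim: s => [|i s IH]; first by rewrite !big_nil size_poly1.
rewrite !big_cons (leq_trans (size_polyMleq _ _)) //.
by move: (Fe i) IH; lia.
Qed.

Lemma prefix_threshold (R : realDomainType) m (s : 'I_m -> R) (x : R) :
  {homo s : i j / (i < j)%N >-> i < j} ->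
  exists2 j, (j <= m)%N & forall l : 'I_m, (s l < x) = (l < j)%N.
Proof.
move=> s_incr; pose P n := [forall l : 'I_m, (s l < x) ==> (l < n)%N].
have Pm : P m by apply/forallP => l; rewrite ltn_ord implybT.
have exP : exists n, P n by exists m.
case: (ex_minnP exP) => j /forallP Pj minj; exists j => [|l]; first exact: minj.
apply/idP/idP => [|lj]; first exact/implyP/Pj.
rewrite ltNge; apply/negP => xs; suff : P l by move=> /minj; rewrite leqNgt lj.
apply/forallP => l'; apply/implyP => l'x; rewrite ltnNge leq_eqVlt; apply/negP.
move=> /orP[/eqP/val_inj ll'|/s_incr ll'].
  by move: xs; rewrite ll' leNgt l'x.
by move: (lt_trans ll' l'x); rewrite ltNge xs.
Qed.

(* The point at infinity, present when [m = h.*2 + r - 1], contributes no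
   factor. *)
Definition window_poly (R : realType) m (s : 'I_m -> R) (h r i : nat) :
    {poly R} :=
  (-1) ^+ (i - r) *: \prod_(l < m) ((s l)%:P - 'X) ^+ (2 - in_window h r i l).

(** Over the whole cycle the multiplicities add up to 2(2h + r) - 2h = 2(h + r); omitting the point
    at infinity lowers this by at least one. *)
Lemma size_window_poly (R : realType) m (s : 'I_m -> R) (h r i : nat)
    (o : bool) :
  (m = h.*2 + r - o)%N -> (i < h.*2 + r)%N ->
  (size (window_poly s h r i) <= ((h + r).*2 - o).+1)%N.
Proof.
move=> mE iM; rewrite (leq_trans (size_scale_leq _ _)) //.
have szX (l : 'I_m) : size ((s l)%:P - 'X) = 2.
  by rewrite -opprB size_polyN size_XsubC.
pose e (l : 'I_m) := (2 - in_window h r i l)%N.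
rewrite (leq_trans (@size_prod_le _ _ _ _ e _)) //.
  by move=> l; rewrite (leq_trans (size_poly_exp_leq _ _)) // szX mul1n.
have -> : (\sum_(l < m) e l = 2 * m - \sum_(l < m) in_window h r i l)%N.
  rewrite sumnB => [|l _]; last by case: in_window.
  by rewrite sum_nat_const card_ord mulnC.
rewrite sum_in_window //; [lia|by rewrite mE leq_subr].
Qed.

Lemma root_window_poly (R : realType) m (s : 'I_m -> R) (h r i : nat)
    (l : 'I_m) :
  (window_poly s h r i).[s l] = 0.
Proof.
rewrite hornerZ horner_prod (bigD1 l) //= horner_exp !hornerE subrr.
have -> : 0 ^+ (2 - in_window h r i l) = 0 :> R.
  by rewrite expr0n; case: in_window.
by rewrite /= mulr0 mul0r.
Qed.

(** Nodes outside the window contribute squares, so only the simple factors of window nodes to the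
    left of [x] are negative; the scalar in front adds the exponent [i - r]. *)
Lemma window_poly_gt0 (R : realType) m (s : 'I_m -> R) (h r i j : nat) (x : R) :
  (j <= m)%N -> (forall l : 'I_m, (s l < x) = (l < j)%N) ->
  (forall l, s l != x) ->
  (0 < (window_poly s h r i).[x]) =
    ~~ odd ((i - r) + \sum_(l < j) in_window h r i l).
Proof.
move=> jm sx s_neq; rewrite -sgr_gt0.
suff -> : Num.sg (window_poly s h r i).[x] =
    (-1) ^+ ((i - r) + \sum_(l < j) in_window h r i l).
  by rewrite -signr_odd; case: odd; rewrite ?expr1 ?expr0 ?ltr0N1 ?ltr01.
rewrite hornerZ horner_prod sgrM sgr_prod sgrX sgrN1 exprD; congr (_ * _).
rewrite -prodrXr (big_ord_widen m (fun l => (-1) ^+ in_window h r i l)) //.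
rewrite [RHS]big_mkcond; apply: eq_bigr => l _.
rewrite horner_exp !hornerE sgrX -sx -subr_lt0.
have : s l - x != 0 by rewrite subr_eq0.
case: ltgtP => [/ltr0_sg ->|/gtr0_sg ->|->] //.
  by case: in_window; rewrite // expr2 mulN1r opprK.
by rewrite expr1n.
Qed.

(** Double counting of the pairs of an index [i] and a point [x] at which the [i]-th window
    polynomial is positive: each [x] lies in exactly [h + r] pairs, each [i] in at most [k]. *)
Lemma window_count (R : realType) m (s : 'I_m -> R) (xs : seq R)
    (h r k : nat) (o : bool) :
  (m = h.*2 + r - o)%N -> {homo s : i j / (i < j)%N >-> i < j} ->
  {in xs, forall x l, s l != x} ->
  (forall p : {poly R}, (size p <= ((h + r).*2 - o).+1)%N ->
     (forall l, p.[s l] = 0) -> (count (fun x => 0 < p.[x])%R xs <= k)%N) ->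
  ((h + r) * size xs <= (h.*2 + r) * k)%N.
Proof.
move=> mE s_incr xs_s count_le.
rewrite -[X in (_ <= X * _)%N]card_ord -sum_nat_const.
pose pos (i : 'I_(h.*2 + r)) x : nat := (0 < (window_poly s h r i).[x])%R.
apply: (@leq_trans (\sum_(i < h.*2 + r) \sum_(x <- xs) pos i x)%N); last first.
  apply: leq_sum => i _; rewrite -big_mkcond sum1_count.
  by apply: count_le => [|l]; [exact: size_window_poly|exact: root_window_poly].
rewrite exchange_big /= -[size xs]count_predT -iter_addn_0 -big_const_seq.
rewrite leq_eqVlt; apply/orP; left; apply/eqP.
apply: eq_big_seq => x xxs.
have [j jm sx] := prefix_threshold x s_incr.
rewrite -(@sum_window_parity h r j);
  last by rewrite (leq_trans jm) // mE leq_subr.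
apply: eq_bigr => i _; rewrite /pos (window_poly_gt0 _ _ _ jm sx) //.
exact: xs_s.
Qed.

Lemma size_cyclic_subset (R : realType) d n (t : 'I_n -> R)
    (Y : {fset 'rV[R]_d}) :
  (0 < d)%N -> injective t -> (Y `<=` cyclic_vertices d t)%fset ->
  size [seq i <- enum 'I_n | moment_curve d (t i) \in Y] = #|` Y|.
Proof.
move=> d_gt0 t_inj YX; rewrite -(size_map (fun i => moment_curve d (t i))).
apply/perm_size/uniq_perm; [|exact: fset_uniq|].
  rewrite map_inj_uniq ?(filter_uniq _ (enum_uniq _)) //.
  by move=> i j /(@moment_curve_inj R _ d_gt0)/t_inj.
move=> y; apply/mapP/idP => [[i + ->]|yY].
  by rewrite mem_filter => /andP[].
have /imfsetP[/= i _ yE] := fsubsetP YX _ yY.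
by exists i => //; rewrite mem_filter mem_enum -yE yY.
Qed.

Lemma feasible_upper (R : realType) (d k lambda n h r : nat) :
  (0 < d)%N -> (lambda <= d)%N -> lambda = r.+1 -> uphalf d = (h + r)%N ->
  zeta_feasible R d k lambda n ->
  [/\ (0 < k)%N, ((d - lambda).+1 <= n)%N &
      (uphalf d * (n - (d - lambda).+1) <= (h.*2 + r) * k.-1)%N].
Proof.
move=> d_gt0 ld lE dE [t t_incr [L [planeL KL [S [SX cardS SL]]]]].
have t_inj := homo_ord_inj t_incr.
have g_inj : injective (fun i => moment_curve d (t i)).
  by move=> i j /(@moment_curve_inj R _ d_gt0)/t_inj.
set m := (d - lambda)%N in planeL cardS *.
pose P i := moment_curve d (t i) \in S.
pose iS := [seq i <- enum 'I_n | P i]; pose iT := [seq i <- enum 'I_n | ~~ P i].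
have sziS : size iS = m.+1 by rewrite size_cyclic_subset.
have sziT : (size iT = n - m.+1)%N.
  have := count_predC P (enum 'I_n).
  rewrite -!size_filter -/iS sziS size_enum_ord.
  by rewrite -[[seq _ <- _ | predC _ _]]/iT; lia.
have mn : (m < n)%N.
  by rewrite -sziS -[leqRHS]size_enum_ord size_filter count_size.
have n_gt0 : (0 < n)%N by apply: leq_ltn_trans mn.
pose i0 : 'I_n := Ordinal n_gt0.
pose s (l : 'I_m.+1) := t (nth i0 iS l).
have s_incr : {homo s : i j / (i < j)%N >-> i < j}.
  move=> i j ij; apply: t_incr.
  apply: (@sorted_ltn_nth _ (fun i j : 'I_n => (i < j)%N)) => //;
    rewrite ?inE ?sziS //.
    by move=> ? ? ?; exact: ltn_trans.
  apply: sorted_filter; first by move=> ? ? ?; exact: ltn_trans.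
  by have := iota_ltn_sorted 0 n; rewrite -val_enum_ord sorted_map.
have sS l : moment_curve d (s l) \in S.
  have : nth i0 iS l \in iS by rewrite mem_nth ?sziS.
  by rewrite mem_filter => /andP[].
(* If [p] were positive at [k] points, the affine function of [p] would be positive on their hull,
   which meets [L], where it vanishes. *)
have count_lt (p : {poly R}) : (size p <= d.+1)%N -> (forall l, p.[s l] = 0) ->
    (count (fun x => 0 < p.[x])%R [seq t i | i <- iT] < k)%N.
  move=> szp p_s; rewrite ltnNge; apply/negP.
  rewrite count_map -size_filter => k_le.
  set Q := [seq i <- iT | _] in k_le.
  pose K := [fset x in [seq moment_curve d (t i) | i <- take k Q]]%fset.
  have KX : (K `<=` cyclic_vertices d t)%fset.
    apply/fsubsetP => x; rewrite inE => /mapP[i _ ->].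
    by apply/imfsetP; exists i.
  have cardK : #|` K| = k.
    rewrite card_fseq undup_id ?size_map ?size_takel //.
    rewrite map_inj_uniq // take_uniq //.
    by rewrite (filter_uniq _ (filter_uniq _ (enum_uniq _))).
  have [x [Lx Kx]] := KL K KX cardK.
  have x0 := plane_affine_eq0 (homo_ord_inj s_incr) (leq_subr _ _) planeL
    (fun l => SL _ (sS l)) szp p_s Lx.
  suff : 0 < linear_part p x + p`_0 by rewrite x0 ltxx.
  apply: convex_hull_gt0 Kx => y /=; rewrite inE => /mapP[i + ->].
  move=> /mem_take; rewrite mem_filter => /andP[/= pi _].
  by rewrite linear_part_moment_curve // subrK.
(* The zero polynomial is positive nowhere, so its count 0 is already less than [k]. *)
have k_gt0 : (0 < k)%N.
  have := count_lt 0; rewrite size_poly0 => /(_ isT (fun=> horner0 _)).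
  exact: leq_ltn_trans.
split=> //.
rewrite -sziT -(size_map t) dE.
(* The flag [odd d] stands for the point at infinity, which completes the [m.+1] nodes to a cycle of
   [h.*2 + r]. *)
apply: (@window_count R m.+1 s _ h r k.-1 (odd d)) => //.
- rewrite /m; have := odd_double_half d.
  by move: dE; rewrite uphalf_half lE; lia.
- move=> _ /mapP[i + ->] l; rewrite mem_filter => /andP[+ _].
  by apply: contra => /eqP e; rewrite /P -e; exact: sS.
- move=> p szp p_s; have szp' : (size p <= d.+1)%N.
    apply: leq_trans szp _; have := odd_double_half d.
    by move: dE; rewrite uphalf_half; lia.
  by rewrite -ltnS prednK //; exact: count_lt.
Qed.

(** * Lower bound *)

Lemma pigeonhole_modn (I : seq nat) (a c : nat) :
  (c * a < size I)%N -> {in I, forall i, i %% a.+1 < a}%N ->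
  exists l, [/\ (l < a)%N & (c < count (fun i => i %% a.+1 == l) I)%N].
Proof.
move=> cI Imod; apply: contrapT => noL.
have : (\sum_(l < a) count (fun i => i %% a.+1 == l) I <= \sum_(l < a) c)%N.
  apply: leq_sum => l _; rewrite leqNgt; apply/negP => cl.
  by apply: noL; exists l.
rewrite sum_nat_const card_ord mulnC leqNgt => /negP; apply.
apply: leq_trans cI _.
under eq_bigr do rewrite -sum1_count big_mkcond /=.
rewrite exchange_big /= -sum1_size leq_eqVlt; apply/orP; left; apply/eqP.
apply: eq_big_seq => i iI; rewrite -big_mkcond /=.
rewrite (big_pred1 (Ordinal (Imod i iI))) // => l.
Qed.

(** Blocks have length [a.+1], and residue [a] marks the points of S. Members of [I] with a common
    residue lie in different blocks, so the end of the earlier block separates them: even places of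
    [u] list such members, odd places the ends of their blocks. *)
Lemma interlacing_residues (I : seq nat) (a d m : nat) :
  (0 < d)%N -> sorted ltn I ->
  (uphalf d * a < size I)%N -> {in I, forall i, i %% a.+1 < a}%N ->
  {in I, forall i, i < (m + odd d) * a.+1}%N ->
  exists u : nat -> nat,
    [/\ forall e, (e <= d)%N -> (u e < u e.+1)%N,
        forall e, (e <= d.+1)%N -> ~~ odd e -> u e \in I &
        forall e, (e <= d.+1)%N -> odd e ->
          (u e %% a.+1 = a)%N /\ (u e < m * a.+1)%N].
Proof.
move=> d_gt0 I_sorted cI Imod I_lt.
have [l [la cl]] := pigeonhole_modn cI Imod.
pose J := [seq i <- I | i %% a.+1 == l]%N.
have szJ : (uphalf d < size J)%N by rewrite size_filter.
have J_lt i j : (i < j < size J)%N -> (nth 0 J i < nth 0 J j)%N.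
  move=> ij; apply: (sorted_ltn_nth ltn_trans) => //; rewrite ?inE; try lia.
  by apply: (sorted_filter ltn_trans).
have JP i : (i < size J)%N ->
    nth 0%N J i \in I /\ (nth 0 J i = nth 0 J i %/ a.+1 * a.+1 + l)%N.
  move=> /(mem_nth 0%N); rewrite mem_filter => /andP[/eqP <- JI].
  by rewrite -divn_eq.
pose q i := (nth 0 J i %/ a.+1)%N.
have q_lt i j : (i < j < size J)%N -> (q i < q j)%N.
  move=> ij; have := J_lt _ _ ij; have /andP[ij' jJ] := ij.
  rewrite (JP i _).2 ?(ltn_trans ij') // (JP j _).2 // -/(q i) -/(q j).
  by rewrite ltn_add2r ltn_pmul2r.
exists (fun e => if odd e then q e./2 * a.+1 + a else nth 0 J e./2)%N; split.
- move=> e ed /=; rewrite uphalf_half; case: ifPn => eodd /=; last first.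
    rewrite add0n (JP e./2 _).2 -/(q _); first by rewrite ltn_add2l.
    by apply: leq_ltn_trans szJ; lia.
  have eJ : (e./2 < e./2.+1 < size J)%N.
    by rewrite leqnn (leq_ltn_trans _ szJ) //; lia.
  rewrite add1n (JP e./2.+1 _).2 -/(q _); last by case/andP: eJ.
  by have := q_lt _ _ eJ; nia.
- move=> e ed /negPf ->; apply: (JP _ _).1.
  by apply: leq_ltn_trans szJ; lia.
- move=> e ed eodd; rewrite eodd; split.
    by rewrite modnMDl modn_small.
  suff : (q e./2 < m)%N by nia.
  have q_bound i : (i < size J)%N -> (q i < m + odd d)%N.
    by move=> iJ; rewrite /q ltn_divLR // I_lt ?(JP i iJ).1.
  (* For even [d] every block ends in a point of S. For odd [d] the last one need not, but each odd
     place is followed by a further member of [J], so its block is not the last. *)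
  case: (boolP (odd d)) => dodd; last first.
    have := q_bound e./2; rewrite (negPf dodd) addn0; apply.
    by apply: leq_ltn_trans szJ; lia.
  have eJ : (e./2 < e./2.+1 < size J)%N.
    by rewrite leqnn (leq_ltn_trans _ szJ) //; lia.
  have := q_lt _ _ eJ; have := q_bound e./2.+1; rewrite dodd.
  by case/andP: eJ => _ -> /(_ isT); lia.
Qed.

Lemma convex_set_hull (R : realType) d (A : set 'rV[R]_d) :
  convex_set (convex_hull A : set (convex_lmodType 'rV[R]_d)).
Proof.
move=> x y t; rewrite !inE => Ax Ay C [convC AC].
have := convC x y t; rewrite !inE; apply; [exact: Ax|exact: Ay].
Qed.

Lemma convex_set_translate (R : realType) d (o : 'rV[R]_d)
    (V : {vspace 'rV[R]_d}) :
  convex_set ([set o + v | v in [set` V]] : set (convex_lmodType 'rV[R]_d)).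
Proof.
move=> x y t; rewrite !inE => -[/= v vV <-] [/= w wV <-].
exists (t%:num *: v + (1 - t%:num) *: w); first by rewrite rpredD ?rpredZ.
transitivity (t%:num *: (o + v) + (1 - t%:num) *: (o + w)) => //.
by rewrite !scalerDr addrACA -scalerDl [t%:num + _]addrC subrK scale1r.
Qed.

(* Radon's theorem, the signs of the dependence giving the partition. *)
Lemma alternating_convex_meet (R : realType) d (u : 'I_d.+2 -> R)
    (C1 C2 : set 'rV[R]_d) :
  {homo u : i j / (i < j)%N >-> i < j} ->
  convex_set (C1 : set (convex_lmodType 'rV[R]_d)) ->
  convex_set (C2 : set (convex_lmodType 'rV[R]_d)) ->
  (forall e : 'I_d.+2, ~~ odd e -> C1 (moment_curve d (u e))) ->
  (forall e : 'I_d.+2, odd e -> C2 (moment_curve d (u e))) ->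
  C1 `&` C2 !=set0.
Proof.
move=> u_incr convC1 convC2 C1u C2u.
have [w w_gt0 dep] := alternating_dependence u_incr.
have split_sum (p : {poly R}) : (size p <= d.+1)%N ->
    \sum_(e < d.+2 | ~~ odd e) w e * p.[u e] =
    \sum_(e < d.+2 | odd e) w e * p.[u e].
  move=> /dep; rewrite (bigID (fun e : 'I__ => odd e)) /= addrC.
  move/eqP; rewrite addr_eq0 -sumrN => /eqP sumE.
  transitivity (\sum_(e < d.+2 | ~~ odd e) (-1) ^+ e * w e * p.[u e]).
    by apply: eq_bigr => e /negPf eodd; rewrite -signr_odd eodd expr0 mul1r.
  rewrite sumE; apply: eq_bigr => e eodd.
  by rewrite -signr_odd eodd expr1 mulN1r mulNr opprK.
(* The test polynomial 1 equates the total weights of the two sides, and the powers of X equate the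
   weighted sums of points coordinatewise. *)
have split_weight : \sum_(e < d.+2 | ~~ odd e) w e =
    \sum_(e < d.+2 | odd e) w e.
  have := split_sum 1; rewrite size_poly1 => /(_ isT).
  under eq_bigr do rewrite hornerC mulr1.
  by under [RHS]eq_bigr do rewrite hornerC mulr1.
have split_point : \sum_(e < d.+2 | ~~ odd e) w e *: moment_curve d (u e) =
    \sum_(e < d.+2 | odd e) w e *: moment_curve d (u e).
  apply/rowP => i; rewrite !summxE.
  have := split_sum 'X^(i.+1); rewrite size_polyXn => /(_ (ltn_ord i)) /=.
  under eq_bigr do rewrite hornerXn.
  under [RHS]eq_bigr do rewrite hornerXn.
  move=> sumE.
  under eq_bigr do rewrite !mxE.
  by under [RHS]eq_bigr do rewrite !mxE.
exists ((\sum_(e < d.+2 | ~~ odd e) w e)^-1 *: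
  \sum_(e < d.+2 | ~~ odd e) w e *: moment_curve d (u e)).
split.
  rewrite -[X in X^-1]big_filter -[X in _ *: X]big_filter.
  apply: convex_set_weighted_mean => //.
    suff : (ord0 : 'I_d.+2) \in
        [seq e : 'I_d.+2 <- index_enum 'I_d.+2 | ~~ odd e].
      by case: [seq _ <- _ | _].
    by rewrite mem_filter mem_index_enum.
  by move=> e; rewrite mem_filter => /andP[/C1u].
rewrite split_point split_weight.
rewrite -[X in X^-1]big_filter -[X in _ *: X]big_filter.
apply: convex_set_weighted_mean => //.
  suff : (lift ord0 ord0 : 'I_d.+2) \in
      [seq e : 'I_d.+2 <- index_enum 'I_d.+2 | odd e].
    by case: [seq _ <- _ | _].
  by rewrite mem_filter mem_index_enum.
by move=> e; rewrite mem_filter => /andP[/C2u].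
Qed.

Lemma feasible_lower (R : realType) (d k lambda r h : nat) :
  (0 < d)%N -> (lambda <= d)%N -> lambda = r.+1 -> uphalf d = (h + r)%N ->
  (0 < k)%N ->
  zeta_feasible R d k lambda
    ((d - lambda).+1 + (h.*2 + r) * (k.-1 %/ uphalf d)).
Proof.
move=> d_gt0 ld lE dE k_gt0.
set a := (k.-1 %/ uphalf d)%N; set m := (d - lambda)%N.
have a_le : (uphalf d * a <= k.-1)%N by rewrite mulnC leq_divM.
clearbody a.
have mE : (m.+1 + odd d = h.*2 + r)%N.
  rewrite /m; have := odd_double_half d.
  by move: dE; rewrite uphalf_half lE; lia.
set n := (m.+1 + _)%N.
pose t (i : 'I_n) : R := i%:R.
have t_incr : {homo t : i j / (i < j)%N >-> i < j}.
  by move=> i j; rewrite ltr_nat.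
(* There are [m.+1] blocks of [a] points, each followed by a point of S, and for odd [d] one more
   block of [a] points with no end point. *)
have nE : (n = m.+1 * a.+1 + odd d * a)%N by rewrite /n -mE; lia.
exists t => //.
have s_lt (l : 'I_m.+1) : (l * a.+1 + a < n)%N.
  rewrite nE (@leq_trans (m.+1 * a.+1)%N) ?leq_addr //.
  by rewrite -addnS -mulSnr leq_mul2r ltn_ord orbT.
pose s (l : 'I_m.+1) : R := (l * a.+1 + a)%:R.
have s_inj : injective s.
  move=> i j /eqP; rewrite eqr_nat eqn_add2r eqn_pmul2r // => /eqP.
  exact: val_inj.
pose L := [set moment_curve d (s ord0) + v | v in [set` <<chords d s>>%VS]].
have sL l : L (moment_curve d (s l)).
  exists (moment_curve d (s l) - moment_curve d (s ord0));
    last by rewrite addrC subrK.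
  case: (unliftP ord0 l) => [j|] ->; last by rewrite subrr /= mem0v.
  by rewrite /= -nth_chords memv_span // mem_nth // (size_tuple (chords d s)).
have SX : (cyclic_vertices d s `<=` cyclic_vertices d t)%fset.
  apply/fsubsetP => _ /imfsetP[/= l _ ->].
  by apply/imfsetP; exists (Ordinal (s_lt l)).
exists L; split.
- exists (moment_curve d (s ord0)), <<chords d s>>%VS; split => //.
  have /eqP -> := chords_free s_inj (leq_subr lambda d).
  by rewrite (size_tuple (chords d s)).
- move=> K KX cardK.
  pose I := [seq val i | i <- enum 'I_n & moment_curve d (t i) \in K].
  have szI : size I = k.
    by rewrite size_map size_cyclic_subset //; exact: homo_ord_inj.
  have IK i : i \in I -> (i < n)%N /\ moment_curve d i%:R \in K.
    move=> /mapP[j + ->]; rewrite mem_filter => /andP[jK _].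
    by split; [exact: ltn_ord|].
  (* A point of S in [K] lies in both sets; otherwise every residue is below [a] and the interlacing
     applies. *)
  have [[i iI ia]|noS] := pselect (exists2 i, i \in I & (i %% a.+1 = a)%N).
    have [i_n iK] := IK i iI.
    have q_lt : (i %/ a.+1 < m.+1)%N.
      rewrite -(ltn_pmul2r (ltn0Sn a)) -(ltn_add2r a).
      rewrite -[X in (_ + X < _)%N]ia -divn_eq.
      by rewrite (leq_trans i_n) // nE leq_add2l; case: odd; rewrite ?mul1n.
    exists (moment_curve d i%:R); split; last exact: sub_gen_smallest.
    have := sL (Ordinal q_lt).
    by rewrite /s /= -[X in (_ + X)%N]ia -divn_eq.
  have I_sorted : sorted ltn I.
    rewrite /I sorted_map; apply: sorted_filter.
      by move=> ? ? ?; exact: ltn_trans.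
    by have := iota_ltn_sorted 0 n; rewrite -val_enum_ord sorted_map.
  have cI : (uphalf d * a < size I)%N.
    by rewrite szI -(prednK k_gt0) ltnS.
  have Imod : {in I, forall i, i %% a.+1 < a}%N.
    move=> i iI; have := ltn_pmod i (ltn0Sn a); rewrite ltnS leq_eqVlt.
    by case/orP => // /eqP ia; case: noS; exists i.
  have I_lt : {in I, forall i, i < (m.+1 + odd d) * a.+1}%N.
    move=> i /IK[i_n _]; apply: leq_trans i_n _.
    by rewrite nE mulnDl leq_add2l leq_mul2l leqnSn orbT.
  have [u [u_lt uI uS]] := interlacing_residues d_gt0 I_sorted cI Imod I_lt.
  rewrite setIC.
  apply: (@alternating_convex_meet R d (fun e => (u e)%:R)).
  + move=> i j ij; rewrite ltr_nat.
    have D_conv : {in gtn d.+2 &,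
        forall i j k, (i < k < j)%N -> k \in gtn d.+2}.
      by move=> ? ? _ + ? /andP[_ ]; rewrite !inE => /[swap]; exact: ltn_trans.
    apply: (homo_ltn_in ltn_trans D_conv) => //; rewrite ?inE //.
    by move=> e _; rewrite inE => /u_lt.
  + exact: convex_set_hull.
  + exact: convex_set_translate.
  + move=> e eodd; apply: sub_gen_smallest.
    by apply: (IK _ _).2; apply: uI => //; rewrite -ltnS.
  + move=> e eodd; have [ua u_m] : (u e %% a.+1 = a)%N /\ (u e < m.+1 * a.+1)%N.
      by apply: uS => //; rewrite -ltnS.
    have q_lt : (u e %/ a.+1 < m.+1)%N by rewrite ltn_divLR.
    have := sL (Ordinal q_lt).
    by rewrite /s /= -[X in (_ + X)%N]ua -divn_eq.
- exists (cyclic_vertices d s); split => //.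
    rewrite /cyclic_vertices card_imfset /=; last first.
      by move=> i j /(@moment_curve_inj R _ d_gt0)/s_inj.
    by rewrite -cardE card_ord.
  by move=> _ /= /imfsetP[/= l _ ->].
Qed.

(** * The limit *)

Lemma zeta_bounds (R : realType) (d k lambda r h : nat) :
  (0 < d)%N -> (lambda <= d)%N -> lambda = r.+1 -> uphalf d = (h + r)%N ->
  (0 < k)%N ->
  ((d - lambda).+1 + (h.*2 + r) * (k.-1 %/ uphalf d) <= zeta R k d lambda)%N /\
  (uphalf d * (zeta R k d lambda - (d - lambda).+1) <= (h.*2 + r) * k.-1)%N.
Proof.
move=> d_gt0 ld lE dE k_gt0.
have upper n := @feasible_upper R d k lambda n h r d_gt0 ld lE dE.
have lower := feasible_lower R d_gt0 ld lE dE k_gt0.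
have c_gt0 : (0 < uphalf d)%N.
  by rewrite uphalf_half; have := odd_double_half d; lia.
pose maximal n := zeta_feasible R d k lambda n /\
  forall m, zeta_feasible R d k lambda m -> (m <= n)%N.
have ex_maximal : exists n, maximal n.
  pose P n := `[< zeta_feasible R d k lambda n >].
  have exP : exists n, P n.
    exists ((d - lambda).+1 + (h.*2 + r) * (k.-1 %/ uphalf d))%N.
    exact/asboolP.
  have boundP n : P n -> (n <= (h.*2 + r) * k.-1 + (d - lambda).+1)%N.
    move=> /asboolP/upper[_ _ le_n]; rewrite addnC -leq_subLR.
    apply: leq_trans le_n.
    by rewrite leq_pmull.
  case: (ex_maxnP exP boundP) => n /asboolP n_feas n_max.
  by exists n; split => // m m_feas; apply: n_max; apply/asboolP.
(* Since a maximum exists, [xget] returns it and not the default 0. *)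
have [z_feas z_max] : maximal (zeta R k d lambda).
  exact: (xgetPex 0%N ex_maximal).
split; first exact: z_max.
by have [] := upper _ z_feas.
Qed.

Unset Implicit Arguments.

Theorem theorem3 (R : realType) (d lambda : nat)
    (hd : (0 < d)%N) (hlambda : (0 < lambda)%N) (hle : (lambda <= d)%N)
    (halpha : alpha R d lambda < 1) :
  (fun k : nat => (zeta R k d lambda)%:R / k%:R : R) @ \oo
    --> (2 - alpha R d lambda : R).
Proof.
have lE : lambda = lambda.-1.+1 by rewrite prednK.
set r := lambda.-1 in lE; set c := uphalf d.
have c_gt0 : (0 < c)%N.
  by rewrite /c uphalf_half; have := odd_double_half d; lia.
have cR_gt0 : 0 < c%:R :> R by rewrite ltr0n.
have alphaE : alpha R d lambda = r%:R / c%:R by rewrite /alpha lE -natr1 addrK.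
(* The bound on [alpha] makes the half-length [c - r] of the windows positive. *)
have rc : (r < c)%N.
  by move: halpha; rewrite alphaE ltr_pdivrMr // mul1r ltr_nat.
have dE : c = (c - r + r)%N by rewrite subnK // ltnW.
set M := ((c - r).*2 + r)%N; set m := (d - lambda).+1.
have -> : 2 - alpha R d lambda = M%:R / c%:R.
  have -> : M = (2 * c - r)%N by rewrite /M; lia.
  by rewrite alphaE natrB ?natrM; [field; rewrite gt_eqF|lia].
apply/cvgrPdist_le => /= e e_gt0.
have [N _ N_large] := nbhs_infty_gtr ((m + M)%:R / e).
exists N.+1 => // k /= Nk; have k_gt0 : (0 < k)%N by apply: leq_trans Nk.
have kR_gt0 : 0 < k%:R :> R by rewrite ltr0n.
have [lower upper] := zeta_bounds R hd hle lE dE k_gt0.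
move: lower upper; rewrite -/c -/M -/m.
set z := zeta R k d lambda => lower upper.
have k_large : (m + M)%:R <= e * k%:R.
  by rewrite mulrC -ler_pdivrMr // ltW // N_large //= ltnW.
(* Clearing denominators, both bounds take the form |M k - c z| <= c (m + M): [m] absorbs the points
   of S, and [M] the rounding in the floor. Dividing by c k leaves (m + M) / k, which is at most [e]
   by the choice of [N]. *)
have z_le : (c * z <= M * k + c * (m + M))%N.
  apply: (@leq_trans (c * (m + (z - m)))%N);
    first by rewrite leq_mul2l -leq_subLR leqnn orbT.
  rewrite mulnDr addnC leq_add //; last by rewrite leq_mul2l leq_addr orbT.
  by rewrite (leq_trans upper) // leq_mul2l leq_pred orbT.
have z_ge : (M * k <= c * z + c * (m + M))%N.
  apply: (@leq_trans (M * (k.-1 %/ c * c + c))%N).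
    by rewrite leq_mul2l -[leqLHS](prednK k_gt0) -mulSnr ltn_ceil // orbT.
  have : (c * (m + M * (k.-1 %/ c)) <= c * z)%N by rewrite leq_mul2l lower orbT.
  set q := (k.-1 %/ c)%N => cz; rewrite -(leq_add2r (c * M)) in cz.
  rewrite mulnDr (mulnC M c) (leq_trans _ (leq_trans cz _)) //;
    last by rewrite leq_add2l leq_mul2l leq_addl orbT.
  by rewrite leq_add2r mulnDr mulnA [(M * q * c)%N]mulnC leq_addl.
have ck_gt0 : 0 < c%:R * k%:R :> R by rewrite mulr_gt0.
have -> : M%:R / c%:R - z%:R / k%:R =
    (M%:R * k%:R - c%:R * z%:R) / (c%:R * k%:R) :> R.
  by field; rewrite !gt_eqF.
rewrite normrM normfV (gtr0_norm ck_gt0) ler_pdivrMr //.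
apply: (@le_trans _ _ (c%:R * (m + M)%:R)); last first.
  by rewrite mulrCA ler_pM2l.
rewrite ler_norml; move: z_le z_ge.
rewrite -!(ler_nat R) !natrD !natrM !natrD => z_le z_ge.
by apply/andP; split; lra.
Qed.
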